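(* Let $G$ be a connected block graph. Then the following are equivalent: (1) $G$ is IPP-extremal; (2) $G$ is IndPP-extremal; (3) at most one block of $G$ is even.
   Context: All graphs are finite, simple, and nonnull (at least one vertex). A graph is even if it has an even number of vertices. An induced path in $G$ is an induced subgraph of $G$ that is a path (possibly with only one vertex). An isometric path in $G$ is a path in $G$ that is of smallest possible length (number of edges) among all paths in $G$ between its two endpoints (one-vertex paths are isometric). An induced path partition (resp. isometric path partition) of $G$ is a collection of induced (resp. isometric) paths in $G$ whose vertex sets partition $V(G)$; the smallest cardinality of such a collection is denoted by $\text{indpp}(G)$ (resp. $\text{ipp}(G)$). The matching number $\nu(G)$ is the largest cardinality of a matching of $G$. $G$ is IPP-extremal if $\text{ipp}(G) = |V(G)|-\nu(G)$, and IndPP-extremal if $\text{indpp}(G) = |V(G)|-\nu(G)$. A cut-vertex of a graph $G$ on at least two vertices is a vertex $v$ such that $G \setminus v$ has more connected components than $G$. A graph is biconnected if it is connected and has no cut-vertices (so all complete graphs, including those on one and two vertices, are biconnected). A block of $G$ is a maximal biconnected induced subgraph of $G$. A block graph is a graph all of whose blocks are complete graphs. *)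

(* Defs.v *)
From mathcomp Require Import all_boot.

Set Implicit Arguments.
Unset Strict Implicit.
Unset Printing Implicit Defensive.

(* A simple graph is a symmetric irreflexive relation e on a finType T; both   *)
(* properties are hypotheses of the theorem, not of the definitions. Induced   *)
(* subgraphs are represented by their vertex sets.                             *)
Section Graphs.
Variables (T : finType) (e : rel T).
Implicit Types (x y u v : T) (s p q : seq T) (S B : {set T}).
Implicit Types (P M : {set {set T}}).

(* x :: p lists the successive vertices of a path; its length is size p. *)
Definition gpath x p := path e x p && uniq (x :: p).

(* The edges of the subgraph induced by the members of s are exactly the pairs *)
(* of vertices that are consecutive in s.                                      *)
Definition induced_path s :=
  [&& s != [::], uniq s &
      [forall u in s, forall v in s,
         e u v == ((index u s).+1 == index v s)
               || ((index v s).+1 == index u s)]].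

(* Competing paths have no repeated vertex, hence fewer than #|T| edges; this  *)
(* bounds the quantifier (see isometric_pathP).                                *)
Definition isometric_path x p :=
  gpath x p &&
  [forall n : 'I_#|T|, forall q : n.-tuple T,
     gpath x q && (last x q == last x p) ==> (size p <= size q)].

Definition induced_path_set S :=
  [exists n : 'I_#|T|, exists x, exists p : n.-tuple T,
     induced_path (x :: p) && (S == [set:: x :: p])].

Definition isometric_path_set S :=
  [exists n : 'I_#|T|, exists x, exists p : n.-tuple T,
     isometric_path x p && (S == [set:: x :: p])].

(* The paths of a partition are identified with their vertex sets: these are   *)
(* nonempty and pairwise disjoint, so cardinalities agree.                     *)
Definition path_partition (ps : pred {set T}) P :=
  partition P [set: T] && [forall S in P, ps S].

Definition singletons : {set {set T}} := [set [set x] | x : T].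

(* The arg min is meaningful since singletons is a path partition of both      *)
(* kinds (see induced_partition1 and isometric_partition1).                    *)
Definition indpp :=
  #|[arg min_(P < singletons | path_partition induced_path_set P) #|P|]|.

Definition ipp :=
  #|[arg min_(P < singletons | path_partition isometric_path_set P) #|P|]|.

Definition edges : {set {set T}} :=
  [set E | [exists x, exists y, e x y && (E == [set x; y])]].

Definition matching M := (M \subset edges) && trivIset M.

Definition nu := \max_(M : {set {set T}} | matching M) #|M|.

(* The subtraction is never truncated, as nu <= #|T|. *)
Definition IPP_extremal := ipp = #|T| - nu.
Definition IndPP_extremal := indpp = #|T| - nu.

Definition induced_rel S : rel T :=
  [rel x y | [&& x \in S, y \in S & e x y]].

Definition ncomponents S := n_comp (induced_rel S) S.

Definition connected_in S :=
  (S != set0) && [forall x in S, forall y in S, connect (induced_rel S) x y].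

Definition cut_vertex S v :=
  [&& 1 < #|S|, v \in S & ncomponents S < ncomponents (S :\ v)].

Definition biconnected S :=
  connected_in S && [forall v in S, ~~ cut_vertex S v].

Definition block B := maxset biconnected B.

Definition complete_in S :=
  [forall x in S, forall y in S, (x != y) ==> e x y].

Definition connected_graph := connected_in [set: T].

Definition block_graph := [forall B : {set T}, block B ==> complete_in B].

Lemma gpath_ltn x p : gpath x p -> size p < #|T|.
Proof. by case/andP=> _ /card_uniqP up; move: (max_card (mem (x :: p))); rewrite up. Qed.

Lemma isometric_pathP x p :
  reflect (gpath x p /\
           forall q, gpath x q -> last x q = last x p -> size p <= size q)
          (isometric_path x p).
Proof.
apply: (iffP andP) => -[gp min_p]; split=> //.
  move=> q gq lq; have /forallP/(_ (in_tuple q)) :=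
    forallP min_p (Ordinal (gpath_ltn gq)).
  by rewrite gq lq eqxx.
apply/forallP=> n; apply/forallP=> q; apply/implyP=> /andP[gq /eqP].
exact: min_p.
Qed.

Lemma induced_path_setP S :
  reflect (exists2 s, induced_path s & S = [set:: s]) (induced_path_set S).
Proof.
apply: (iffP existsP) => [[n /existsP[x /existsP[p /andP[ip /eqP->]]]]|].
  by exists (x :: p).
case=> -[|x p] ip -> //; have lt_p : size p < #|T|.
  by case/and3P: ip => _ /card_uniqP up _; move: (max_card (mem (x :: p))); rewrite up.
exists (Ordinal lt_p); apply/existsP; exists x; apply/existsP.
by exists (in_tuple p); rewrite ip eqxx.
Qed.

Lemma isometric_path_setP S :
  reflect (exists x p, isometric_path x p /\ S = [set:: x :: p])
          (isometric_path_set S).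
Proof.
apply: (iffP existsP) => [[n /existsP[x /existsP[p /andP[ip /eqP->]]]]|].
  by exists x, p.
case=> x [p [ip ->]]; have gp : gpath x p by case/andP: ip.
exists (Ordinal (gpath_ltn gp)); apply/existsP; exists x; apply/existsP.
by exists (in_tuple p); rewrite ip eqxx.
Qed.

Lemma partition_singletons : partition singletons [set: T].
Proof.
apply/and3P; split.
- apply/eqP/setP=> x; rewrite inE; apply/bigcupP.
  by exists [set x]; rewrite ?set11 ?imset_f.
- apply/trivIsetP=> _ _ /imsetP[x _ ->] /imsetP[y _ ->] neq.
  by rewrite disjoints1 inE; apply: contraNneq neq => ->.
by apply/negP=> /imsetP[x _ /setP/(_ x)]; rewrite !inE eqxx.
Qed.

Lemma isometric_partition1 : path_partition isometric_path_set singletons.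
Proof.
rewrite /path_partition partition_singletons; apply/forall_inP=> _ /imsetP[x _ ->].
apply/isometric_path_setP; exists x, [::]; rewrite set_seq1.
by split=> //; apply/isometric_pathP.
Qed.

Lemma induced_partition1 :
  irreflexive e -> path_partition induced_path_set singletons.
Proof.
move=> eirr; rewrite /path_partition partition_singletons.
apply/forall_inP=> _ /imsetP[x _ ->].
apply/induced_path_setP; exists [:: x]; rewrite ?set_seq1 //.
apply/and3P; split=> //; apply/forall_inP=> u; rewrite inE => /eqP->.
by apply/forall_inP=> v; rewrite inE => /eqP->; rewrite eirr /= eqxx.
Qed.

End Graphs.

(* Main.v *)
Require Import Defs.
From mathcomp Require Import all_boot zify.

(** Write n for the number of vertices. The edges of a matching M, together
    with the vertices that M misses, form an isometric path partition of size
    n - #|M|; isometric paths are induced. Hence indpp <= ipp <= n - nu, and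
    each extremality says that no partition of its kind does better than a
    maximum matching.

    Everything else rests on one property of block graphs: two neighbours of
    v that are connected in the graph minus v are equal or adjacent
    (block_graph_adj), because a path joining them in the graph minus v forms
    together with v a biconnected subgraph, which lies in a complete block. It
    follows that two blocks share at most one vertex (block_eq), and that
    after fixing a root r every vertex v other than r has a parent block, made
    of v and its neighbours on the side of r; each block is the parent block
    of all its vertices but one (block_root, block_parent_or).

    If ipp = n - nu, then at most one block is even. Take a maximum matching M
    and suppose that a block B has two vertices x, y that are not matched by M
    inside B. Joining the parts of x and y by the edge xy yields a path on at
    most four vertices whose successive edges lie in different blocks; it is
    isometric, and the partition becomes smaller, a contradiction
    (ipp_lt_matching). So M matches all vertices of B inside B but at most
    one, for every block B, and the sum over all blocks of the integer parts
    of #|B| / 2 is at most nu <= n / 2. As n - 1 is at most the sum of the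
    #|B| - 1 (card_le_blocks), doubling leaves room for one even block only
    (even_blocks_le1).

    Conversely, an induced path has at most one edge in each block, so a
    partition into k induced paths has n - k edges in total, of which at most
    #|B| / 2 lie in B (induced_partition_bound). If all blocks but B0 are odd,
    root the graph at a vertex of B0: B0 and, for each other block, its set of
    non-root vertices are disjoint cliques that provide a matching with
    #|B| / 2 edges in each block B (nu_ge_half_blocks). Thus n - k <= nu. *)

Set Implicit Arguments.
Unset Strict Implicit.
Unset Printing Implicit Defensive.

(** * Connectivity and biconnectivity of induced subgraphs *)

Lemma mem_split (T : eqType) (x : T) s :
  x \in s -> exists s1 s2, s = s1 ++ x :: s2.
Proof. by case/splitPr=> s1 s2; exists s1, s2. Qed.

Section Graph.
Variables (T : finType) (e : rel T).
Hypotheses (esym : symmetric e) (eirr : irreflexive e).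
Implicit Types (x y z u v w r : T) (p s : seq T) (S A B : {set T}).

Lemma edge_neq x y : e x y -> x != y.
Proof. by apply: contraTneq => ->; rewrite eirr. Qed.

Lemma induced_relE S x y :
  induced_rel e S x y = [&& x \in S, y \in S & e x y].
Proof. by []. Qed.

Lemma induced_connect_sym S : connect_sym (induced_rel e S).
Proof. by apply: sym_connect_sym => x y; rewrite !induced_relE esym andbCA. Qed.

Lemma induced_connectS A B :
  A \subset B -> subrel (connect (induced_rel e A)) (connect (induced_rel e B)).
Proof.
move=> /subsetP sAB; apply: connect_sub => x y /and3P[xA yA exy].
by apply: connect1; rewrite induced_relE !sAB.
Qed.

Lemma path_induced_connect S x p :
    path e x p -> {subset x :: p <= S} ->
  {in x :: p, forall z, connect (induced_rel e S) x z}.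
Proof.
elim: p x => [|y p IHp] x /=; first by move=> _ _ z; rewrite inE => /eqP->.
case/andP=> exy ep sS z; rewrite inE => /predU1P[-> // | zp].
apply: (@connect_trans _ _ y); last first.
  by apply: IHp zp => // t tp; apply: sS; rewrite inE tp orbT.
by apply: connect1; rewrite induced_relE exy !sS ?inE ?eqxx ?orbT.
Qed.

Lemma connect_induced_mem S x y :
  connect (induced_rel e S) x y -> x != y -> (x \in S) && (y \in S).
Proof.
move=> cxy neq; have mem a b : connect (induced_rel e S) a b -> a != b -> a \in S.
  by case/connectP=> -[|c p] /= + ->; rewrite ?eqxx // => /andP[/and3P[]].
by rewrite (mem _ _ cxy) // (mem y x) 1?eq_sym // induced_connect_sym.
Qed.

Lemma path_of_induced S x p :
  x \in S -> path (induced_rel e S) x p -> path e x p /\ {subset x :: p <= S}.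
Proof.
elim: p x => [|y p IHp] x xS /=; first by split=> // z; rewrite inE => /eqP->.
case/andP=> /and3P[_ yS exy] /(IHp _ yS)[-> sS]; rewrite exy; split=> // z.
by rewrite inE => /predU1P[-> // | /sS].
Qed.

Lemma edge_connect S x y :
  x \in S -> y \in S -> e x y -> connect (induced_rel e S) x y.
Proof. by move=> xS yS exy; apply: connect1; rewrite induced_relE xS yS. Qed.

Lemma ncomponents_connected S : connected_in e S -> ncomponents e S = 1.
Proof.
case/andP=> /set0Pn[x xS] /forall_inP/(_ _ xS)/forall_inP cS.
rewrite /ncomponents -(n_comp_connect (induced_connect_sym S) x).
apply: eq_n_comp_r => y; rewrite [RHS]unfold_in.
apply/idP/idP=> [/cS // | cxy]; have [<- // | neq] := eqVneq x y.
by case/andP: (connect_induced_mem cxy neq).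
Qed.

Lemma connected_in_from S x :
    x \in S -> {in S, forall y, connect (induced_rel e S) x y} ->
  connected_in e S.
Proof.
move=> xS cx; apply/andP; split; first by apply/set0Pn; exists x.
apply/forall_inP=> y yS; apply/forall_inP=> z zS.
by rewrite (connect_trans _ (cx z zS)) // induced_connect_sym cx.
Qed.

Lemma biconnectedI S :
    connected_in e S ->
    {in S, forall x, S :\ x = set0 \/ connected_in e (S :\ x)} ->
  biconnected e S.
Proof.
move=> cS cSx; rewrite /biconnected cS; apply/forall_inP=> x xS.
apply/negP=> /and3P[S_gt1 _]; rewrite ncomponents_connected //.
case: (cSx x xS) => [S0 | /ncomponents_connected->]; last by rewrite ltnn.
by move: S_gt1; rewrite (cardsD1 x) xS S0 cards0.
Qed.

Lemma complete_connected S : S != set0 -> complete_in e S -> connected_in e S.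
Proof.
case/set0Pn=> x xS /forall_inP/(_ _ xS)/forall_inP cS.
apply: (connected_in_from xS) => y yS; have [-> // | neq] := eqVneq x y.
by apply: connect1; rewrite induced_relE xS yS (implyP (cS y yS)).
Qed.

Lemma complete_inS A B : A \subset B -> complete_in e B -> complete_in e A.
Proof.
move=> /subsetP sAB /forall_inP cB; apply/forall_inP=> x /sAB xB.
by apply/forall_inP=> y /sAB yB; apply: (forall_inP (cB x xB)).
Qed.

Lemma complete_biconnected S : S != set0 -> complete_in e S -> biconnected e S.
Proof.
move=> S0 cS; apply: biconnectedI; first exact: complete_connected.
move=> x _; have [|Sx0] := eqVneq (S :\ x) set0; [by left | right].
by apply: complete_connected => //; apply: complete_inS cS; apply: subsetDl.
Qed.

(** The path u :: p and v form a cycle, possibly with chords: deleting any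
    vertex of the path leaves at most two pieces, each joined to v by an end of the
    path. *)
Lemma cycle_biconnected v u p :
    path e u p -> uniq (v :: u :: p) -> e v u -> e v (last u p) ->
  biconnected e [set:: v :: u :: p].
Proof.
move=> ep up evu evw; set S := [set:: _]; set s := u :: p.
have vS : v \in S by rewrite !inE eqxx.
have sS z : z \in s -> z \in S by rewrite !inE => ->; rewrite orbT.
have vNs : v \notin s by case/andP: up.
have us : uniq s by case/andP: up.
have cS1 s1 x s2 : s = s1 ++ x :: s2 ->
    {in S :\ x, forall z, connect (induced_rel e (S :\ x)) v z}.
  move=> def_s; have xs : x \in s by rewrite def_s mem_cat mem_head orbT.
  have vx : v != x by apply: contraNneq vNs => ->.
  have vSx : v \in S :\ x by rewrite in_setD1 vx.
  have [s1S s2S] : {subset s1 <= S :\ x} /\ {subset s2 <= S :\ x}.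
    move: us; rewrite def_s cat_uniq /= => /and4P[_ /norP[xs1 _] xs2 _].
    split=> z zs; rewrite in_setD1 sS ?def_s ?mem_cat ?inE ?zs ?orbT ?andbT //.
      by apply: contraNneq xs1 => <-.
    by apply: contraNneq xs2 => <-.
  move=> z; rewrite in_setD1 => /andP[zx]; rewrite in_set inE => /predU1P[-> // |].
  rewrite -/s def_s mem_cat inE (negPf zx) /= => /orP[zs1 | zs2].
    case: s1 s1S zs1 def_s => // a s1 s1S zs1 [ua def_p]; rewrite -{a}ua in s1S zs1.
    apply: (@connect_trans _ _ u).
      by apply: connect1; rewrite induced_relE vSx evu s1S ?mem_head.
    by apply: path_induced_connect zs1 => //; move: ep; rewrite def_p cat_path => /andP[].
  case: s2 s2S zs2 def_s => // a s2 s2S zs2 def_s.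
  have ea : path e a s2.
    by case: s1 def_s {s1S} => [|b s1] [? def_p]; move: ep; rewrite def_p ?cat_path /=;
      [case/andP | case/and4P].
  have la : last u p = last a s2.
    by rewrite -[LHS](last_cons u u) -/s def_s last_cat.
  have cw := path_induced_connect ea s2S.
  apply: (@connect_trans _ _ (last u p)).
    by apply: connect1; rewrite induced_relE vSx evw la s2S ?mem_last.
  by rewrite (connect_trans _ (cw z zs2)) // induced_connect_sym la cw ?mem_last.
apply: biconnectedI.
  apply: (connected_in_from vS) => z.
  rewrite in_set inE => /predU1P[-> // | zs].
  apply: (@connect_trans _ _ u).
    by apply: connect1; rewrite induced_relE vS evu sS ?mem_head.
  exact: path_induced_connect zs.
move=> x; rewrite in_set inE => /predU1P[-> | xs]; right; last first.
  have [s1 [s2 def_s]] : exists s1 s2, s = s1 ++ x :: s2.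
    exact: mem_split.
  have vx : v \in S :\ x.
    by rewrite in_setD1 vS andbT; apply: contraNneq vNs => ->.
  exact: connected_in_from vx (cS1 _ _ _ def_s).
suff ->: S :\ v = [set:: s].
  apply: (@connected_in_from _ u); first by rewrite in_set mem_head.
  by move=> z; rewrite in_set; apply: path_induced_connect => // t; rewrite in_set.
apply/setP=> z; rewrite in_setD1 !in_set in_cons -/s.
by have [->|] := eqVneq z v; rewrite ?(negPf vNs).
Qed.

End Graph.

(** * Separation in block graphs *)

Section BlockGraph.
Variables (T : finType) (e : rel T).
Hypotheses (esym : symmetric e) (eirr : irreflexive e).
Implicit Types (x y z u v w r : T) (p s : seq T) (S A B E : {set T}).

(** Follow a path from r to A and stop at its first vertex x in A; the
    alternative records how x is reached: y is the vertex just before x. *)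
Lemma connected_first_hit A r :
    connected_graph e -> A != set0 ->
  exists2 x, x \in A &
    x = r \/ exists2 y, e y x & y \notin A /\ connect (induced_rel e (~: A)) r y.
Proof.
move=> econn /set0Pn[a aA].
have /connectP[p] : connect (induced_rel e setT) r a.
  by apply: (forall_inP (forall_inP (andP econn).2 r _)).
elim: p r => [|y p IHp] r /=; first by move=> _ <-; exists a; [|left].
case/andP=> /and3P[_ _ ery] ep def_a; have [x xA hit] := IHp y ep def_a.
have [rA | rA] := boolP (r \in A); first by exists r; [|left].
exists x => //; right; case: hit => [def_x | [z ezx [zA cyz]]].
  by exists r; [rewrite def_x | split].
have [yA | yA] := boolP (y \in A).
  have /eqP eyz : y == z.
    by apply: contraLR yA => /(connect_induced_mem esym cyz)/andP[]; rewrite inE.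
  by rewrite eyz (negPf zA) in yA.
exists z => //; split=> //; apply: connect_trans cyz.
by apply: edge_connect; rewrite ?inE.
Qed.

Hypothesis eblock : block_graph e.

Lemma block_complete B : block e B -> complete_in e B.
Proof. by move=> bB; apply: (implyP (forallP eblock B)). Qed.

Lemma block_adj B x y : block e B -> x \in B -> y \in B -> x != y -> e x y.
Proof.
by move=> /block_complete/forall_inP cB /cB/forall_inP cx /cx; apply: implyP.
Qed.

Lemma block_neq0 B : block e B -> B != set0.
Proof. by case/maxsetP=> /andP[/andP[]]. Qed.

(** Blocks of a block graph are maximal cliques, since cliques are biconnected. *)
Lemma block_mem_adj B z :
  block e B -> {in B, forall w, w != z -> e z w} -> z \in B.
Proof.
move=> bB ezB; have /maxsetP[_ maxB] := bB.
suff /maxB <- : biconnected e (z |: B); rewrite ?setU11 ?subsetU1 //.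
apply: (complete_biconnected esym); first by apply/set0Pn; exists z; rewrite setU11.
apply/forall_inP=> a /setU1P[-> | aB]; apply/forall_inP=> b /setU1P[-> | bB'];
  apply/implyP=> neq; rewrite ?eqxx // in neq *.
- by rewrite ezB // eq_sym.
- by rewrite esym ezB.
exact: (block_adj bB).
Qed.

Lemma biconnected_block S : biconnected e S -> exists2 B, block e B & S \subset B.
Proof. by move=> /maxset_exists[B]; exists B. Qed.

Lemma edge_block x y : e x y -> exists2 B, block e B & x \in B /\ y \in B.
Proof.
move=> exy; case: (@biconnected_block [set x; y]) => [|B bB /subsetP sB].
  apply: (complete_biconnected esym); first by apply/set0Pn; exists x; rewrite set21.
  by apply/forall_inP=> a /set2P[]->; apply/forall_inP=> b /set2P[]->;
    rewrite ?eqxx ?exy 1?esym ?exy ?implybT.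
by exists B => //; split; apply: sB; rewrite !inE eqxx ?orbT.
Qed.

(** The separation property on which all arguments about block graphs below
    rest: a path from u to w avoiding v closes up with v to a biconnected
    subgraph, hence lies in a complete block. *)
Lemma block_graph_adj v u w :
  e v u -> e v w -> connect (induced_rel e [set~ v]) u w -> u != w -> e u w.
Proof.
move=> evu evw /connectP[p ep def_w] neq.
case/shortenP: ep def_w => q eq uq _ def_w.
have uv : u \in [set~ v] by rewrite !inE eq_sym (edge_neq eirr).
have [eq' sq] := path_of_induced uv eq.
have vNq : v \notin u :: q by apply/negP=> /sq; rewrite !inE eqxx.
have /biconnected_block[B bB /subsetP sB] : biconnected e [set:: v :: u :: q].
  by apply: cycle_biconnected; rewrite -?def_w //= vNq.
apply: (block_adj bB _ _ neq); apply: sB; rewrite !inE ?eqxx ?orbT //.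
by rewrite def_w -in_cons mem_last orbT.
Qed.

(** All vertices of B other than x are on the same side of x, so z is adjacent
    to them by block_graph_adj and maximality of the clique B applies. *)
Lemma block_absorb B x y z :
    block e B -> x \in B -> y \in B -> x != y -> e x z ->
  connect (induced_rel e [set~ x]) y z -> z \in B.
Proof.
move=> bB xB yB xy exz cyz; apply: (block_mem_adj bB) => w wB wz.
have [-> | wx] := eqVneq w x; first by rewrite esym.
rewrite esym; apply: (@block_graph_adj x) => //.
  by apply: (block_adj bB); rewrite // eq_sym.
apply: connect_trans cyz; have [-> // | wy] := eqVneq w y.
by apply: edge_connect; rewrite ?inE // 1?eq_sym // (block_adj bB).
Qed.

Lemma block_triangle B x y z :
  block e B -> x \in B -> y \in B -> x != y -> e x z -> e y z -> z \in B.
Proof.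
move=> bB xB yB xy exz eyz; apply: (block_absorb bB xB yB xy exz).
by apply: edge_connect; rewrite ?inE // eq_sym // (edge_neq eirr).
Qed.

Lemma block_eq A B x y :
    block e A -> block e B -> x \in A -> y \in A -> x \in B -> y \in B ->
  x != y -> A = B.
Proof.
move=> bA bB xA yA xB yB xy.
wlog suff sAB: A B bA bB xA yA xB yB / A \subset B.
  by apply/eqP; rewrite eqEsubset !sAB.
apply/subsetP=> z zA; have [-> // | zx] := eqVneq z x.
have [-> // | zy] := eqVneq z y.
by apply: (block_triangle bB xB yB xy); apply: (block_adj bA); rewrite // eq_sym.
Qed.

(** * Parent blocks of a rooted block graph *)

(** The block through which v is linked to the root r. It is the
    singleton {r} when v = r. *)
Definition parent_block r v :=
  v |: [set u | e v u & connect (induced_rel e [set~ v]) u r].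

Lemma parent_block_eq B r u v :
    block e B -> v \in B -> u \in B -> u != v ->
  connect (induced_rel e [set~ v]) u r -> parent_block r v = B.
Proof.
move=> bB vB uB uv cur; apply/setP=> z; rewrite !inE.
apply/predU1P/idP=> [[-> // | /andP[evz czr]] | zB].
  apply: (block_absorb bB vB uB _ evz); first by rewrite eq_sym.
  by rewrite (connect_trans cur) // induced_connect_sym.
have [-> | zv] := eqVneq z v; [by left | right].
rewrite (block_adj bB) 1?eq_sym //=; apply: connect_trans cur.
have [-> // | zu] := eqVneq z u.
by apply: edge_connect; rewrite ?inE // (block_adj bB).
Qed.

(** Take for b the first vertex of B on a path from r. If b != r, its
    predecessor on that path is outside B but belongs to the parent block of
    b. *)
Lemma block_root B r : connected_graph e -> block e B ->
  exists2 b, b \in B & b = r \/ parent_block r b != B.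
Proof.
move=> econn bB; have [b bB' [def_b | [y eyb [yB cry]]]] :=
  connected_first_hit r econn (block_neq0 bB); exists b => //; [by left | right].
apply: contraNneq yB => <-; rewrite !inE esym eyb.
rewrite induced_connect_sym // (induced_connectS _ cry) ?orbT //.
by rewrite setCS sub1set.
Qed.

Hypothesis econn : connected_graph e.

Lemma block_parent r v : v != r -> block e (parent_block r v) /\ v \in parent_block r v.
Proof.
move=> vr; split; last by rewrite setU11.
have v0 : [set v] != set0 by apply/set0Pn; exists v; rewrite set11.
have [_ /set1P-> [def_v|]] := connected_first_hit r econn v0.
  by rewrite def_v eqxx in vr.
case=> y eyv [yv cry]; have [B bB [yB vB]] := edge_block eyv.
rewrite (parent_block_eq bB vB yB) //; first by rewrite inE in yv.
by rewrite induced_connect_sym.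
Qed.

(** A path from r that meets {u, v} first in u shows that u is on the side of
    r when v is deleted. Hence at most one vertex of a block fails to have
    it as parent block. *)
Lemma block_parent_or B r u v :
    block e B -> u \in B -> v \in B -> u != v ->
  (u != r /\ parent_block r u = B) \/ (v != r /\ parent_block r v = B).
Proof.
move=> bB uB vB uv.
have A0 : [set u; v] != set0 by apply/set0Pn; exists u; rewrite set21.
have [x xA hit] := connected_first_hit r econn A0.
wlog def_x : u v uB vB uv xA hit {A0} / x = u.
  move=> IH; case/set2P: (xA) => def_x; first exact: IH.
  by apply/or_comm/IH; rewrite // 1?eq_sym // setUC.
rewrite {x}def_x in xA hit; right.
have cur : u = r \/ v != r /\ connect (induced_rel e [set~ v]) u r.
  case: hit => [|[y eyu [yA cry]]]; [by left | right].
  have cyu : connect (induced_rel e [set~ v]) y u.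
    by apply: edge_connect; rewrite // !inE // in yA *; case/norP: yA.
  have cru : connect (induced_rel e [set~ v]) r u.
    by apply: connect_trans cyu; apply: induced_connectS cry; rewrite setCS sub1set set22.
  split; last by rewrite induced_connect_sym.
  have [-> | ru] := eqVneq r u; first by rewrite eq_sym.
  have /andP[] := connect_induced_mem esym cru ru.
  by rewrite !inE eq_sym.
case: cur => [<- | [vr cur]].
  by split; [rewrite eq_sym | apply: (parent_block_eq bB vB uB uv)].
by split=> //; apply: (parent_block_eq bB vB uB uv).
Qed.
End BlockGraph.

(** * Partitions, matchings and path partitions *)

Lemma partition_merge (T : finType) (D : {set T}) (P : {set {set T}}) A B :
    partition P D -> A \in P -> B \in P -> A != B ->
  let P' := (A :|: B) |: (P :\ A) :\ B in
  partition P' D /\ #|P'|.+1 = #|P|.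
Proof.
move=> pP AP BP AB /=; set Q := (P :\ A) :\ B.
have BPA : B \in P :\ A by rewrite in_setD1 eq_sym AB.
have pQ : partition Q ((D :\: A) :\: B) := partitionD1 (partitionD1 pP AP) BPA.
have A0 : A != set0 by apply: contraTneq AP => ->; case/and3P: pP.
have [sAD sBD] := (partitionS pP AP, partitionS pP BP).
have dAB : [disjoint A :|: B & (D :\: A) :\: B].
  by rewrite -setI_eq0; apply/eqP/setP=> x; rewrite !inE; do 2!case: (_ \in _).
have AB0 : A :|: B != set0 by rewrite setU_eq0 negb_and A0.
split.
  have := partitionU1 pQ AB0 dAB; congr partition; apply/setP=> x.
  have := (subsetP sAD x, subsetP sBD x); rewrite !inE.
  by case: (x \in A); case: (x \in B); case: (x \in D) => -[] // sA sB;
    rewrite ?(sA isT) ?(sB isT).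
rewrite cardsU1 (cardsD1 A P) (cardsD1 B (P :\ A)) AP BPA -/Q.
suff -> : A :|: B \notin Q by rewrite /= !add1n.
apply/negP=> /(partitionS pQ) /subsetP sAB; case/set0Pn: A0 => x xA.
by have := sAB x; rewrite !inE xA andbF => /(_ isT).
Qed.

Definition singleton_completion (T : finType) (M : {set {set T}}) :=
  M :|: [set [set x] | x in ~: cover M].

Lemma partition_singleton_completion (T : finType) (M : {set {set T}}) :
    trivIset M -> set0 \notin M ->
  partition (singleton_completion M) [set: T] /\
  #|singleton_completion M| + #|cover M| = #|M| + #|T|.
Proof.
move=> tM M0; set P := singleton_completion M.
have dis A x : A \in M -> x \in ~: cover M -> x \notin A.
  by move=> AM; rewrite inE; apply: contra => xA; apply/bigcupP; exists A.
split.
  apply/and3P; split.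
  - apply/eqP/setP=> x; rewrite inE; apply/bigcupP.
    have [/bigcupP[A AM xA] | xM] := boolP (x \in cover M).
      by exists A; rewrite // inE AM.
    by exists [set x]; rewrite ?set11 // inE imset_f ?orbT // inE.
  - apply/trivIsetP=> A B /setUP[AM | /imsetP[x xM ->]] /setUP[BM | /imsetP[y yM ->]].
    + exact: (trivIsetP tM).
    + by rewrite disjoint_sym disjoints1 (dis A).
    + by rewrite disjoints1 (dis B).
    by rewrite disjoints1 inE; apply: contraNneq => ->.
  rewrite inE negb_or M0; apply/imsetP=> -[x _ /setP/(_ x)].
  by rewrite !inE eqxx.
have := cardsUI M [set [set x] | x in ~: cover M]; rewrite -/P.
rewrite (card_imset _ set1_inj).
suff -> : M :&: [set [set x] | x in ~: cover M] = set0.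
  by rewrite cards0 addn0 => ->; have := cardsC (cover M); lia.
apply/setP=> A; rewrite !inE; apply/negP=> /andP[AM /imsetP[x xM def_A]].
by have /negP[] := dis A x AM xM; rewrite def_A set11.
Qed.

Section Matching.
Variables (T : finType) (e : rel T).
Hypothesis eirr : irreflexive e.
Implicit Types (x y z : T) (E : {set T}) (M : {set {set T}}).

Lemma edgesP E : reflect (exists x y, e x y /\ E = [set x; y]) (E \in edges e).
Proof.
rewrite inE; apply: (iffP existsP) => [[x /existsP[y /andP[exy /eqP->]]] |].
  by exists x, y.
by case=> x [y [exy ->]]; exists x; apply/existsP; exists y; rewrite exy eqxx.
Qed.

Lemma card_edge E : E \in edges e -> #|E| = 2.
Proof. by case/edgesP=> x [y [exy ->]]; rewrite cards2 (edge_neq eirr). Qed.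

Lemma card_cover_matching M : matching e M -> #|cover M| = 2 * #|M|.
Proof.
case/andP=> /subsetP sM /eqP <-; rewrite mulnC -sum_nat_const.
by apply: eq_bigr => E /sM/card_edge.
Qed.

Lemma matchingS M (N : {set {set T}}) : N \subset M -> matching e M -> matching e N.
Proof.
by move=> sNM /andP[sM tM]; rewrite /matching (subset_trans sNM) // (trivIsetS sNM).
Qed.

(** If M leaves at most one vertex of each F i unmatched inside F i, then at
    least #|F i|./2 edges of M lie in F i, and no edge is counted twice. This
    serves twice: with the blocks themselves, and with the
    disjoint cliques of a rooted block graph. *)
Lemma sum_half_le_matching (I : finType) (Q : pred I) (F : I -> {set T}) M :
    matching e M ->
    (forall E i j, E \in M -> Q i -> Q j -> E \subset F i -> E \subset F j -> i = j) ->
    (forall i x y, Q i -> x \in F i -> y \in F i ->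
       {in M, forall E, E \subset F i -> (x \notin E) && (y \notin E)} -> x = y) ->
  \sum_(i | Q i) #|F i|./2 <= #|M|.
Proof.
move=> mM Muniq Mmax; pose MF i := [set E in M | E \subset F i].
have half_le i : Q i -> #|F i|./2 <= #|MF i|.
  move=> Qi; have sMF : MF i \subset M by apply/subsetP=> E; rewrite inE => /andP[].
  have := card_cover_matching (matchingS sMF mM).
  suff : #|F i| <= #|cover (MF i)| + 1 by lia.
  rewrite -(cardsID (cover (MF i)) (F i)) leq_add ?subset_leq_card ?subsetIr //.
  apply/card_le1_eqP=> x y /setDP[xF xM] /setDP[yF yM].
  apply: (Mmax i) => // E EM sE; have EMF : E \in MF i by rewrite inE EM.
  by apply/andP; split; [apply: contra yM | apply: contra xM] => ?;
    apply/bigcupP; exists E.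
apply: leq_trans (leq_sum _ half_le) _.
have -> : \sum_(i | Q i) #|MF i| = \sum_(i | Q i) \sum_(E in M) (E \subset F i).
  apply: eq_bigr => i _; rewrite -sum1dep_card big_mkcondr.
  by apply: eq_bigr => E _; case: (_ \subset _).
rewrite exchange_big -sum1_card; apply: leq_sum => E EM.
have [i /andP[Qi sEi] | no] := pickP [pred i | Q i && (E \subset F i)]; last first.
  by rewrite big1 // => i Qi; move: (no i); rewrite /= Qi /= => ->.
rewrite (bigD1 i) //= sEi big1 // => j /andP[Qj]; apply: contraNeq.
by rewrite eqb0 negbK => sEj; apply/eqP; apply: Muniq EM Qj Qi sEj sEi.
Qed.

Lemma nu_max M : matching e M -> #|M| <= nu e.
Proof. exact: leq_bigmax_cond. Qed.

Lemma nu_attained : exists2 M, matching e M & #|M| = nu e.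
Proof.
have m0 : matching e set0.
  by rewrite /matching sub0set; apply/trivIsetP=> A B; rewrite inE.
have : 0 < #|matching e| by apply/card_gt0P; exists set0.
by case/(eq_bigmax_cond (fun M : {set {set T}} => #|M|)) => M mM def_nu; exists M.
Qed.

Lemma nu_half : 2 * nu e <= #|T|.
Proof.
by have [M mM <-] := nu_attained; rewrite -card_cover_matching // max_card.
Qed.

Lemma partition_matching M : matching e M ->
  partition (singleton_completion M) [set: T] /\
  #|singleton_completion M| = #|T| - #|M|.
Proof.
move=> mM; have /andP[/subsetP sM tM] := mM.
case: (partition_singleton_completion tM) => [|pP card_P].
  by apply/negP=> /sM/card_edge; rewrite cards0.
by split=> //; rewrite card_cover_matching // in card_P; lia.
Qed.

Lemma matching_completion_mem M A x : matching e M ->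
    symmetric e -> A \in singleton_completion M -> x \in A ->
  A = [set x] \/ A \in M /\ exists2 y, e y x & A = [set y; x].
Proof.
move=> /andP[/subsetP sM _] esym /setUP[AM | /imsetP[z _ ->]]; last by move/set1P->; left.
case/edgesP: (sM A AM) => y [z [eyz def_A]]; rewrite {1}def_A => /set2P[]-> ; right.
  by split=> //; exists z; rewrite 1?esym // setUC.
by split=> //; exists y.
Qed.

End Matching.

Section Paths.
Variables (T : finType) (e : rel T).
Hypotheses (esym : symmetric e) (eirr : irreflexive e).
Implicit Types (x y z : T) (S : {set T}) (P : {set {set T}}).

Lemma ipp_le P : path_partition (isometric_path_set e) P -> ipp e <= #|P|.
Proof.
rewrite /ipp; case: arg_minnP => [|Q _ minQ /minQ //].
exact: isometric_partition1.
Qed.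

Lemma ipp_attained :
  exists2 P, path_partition (isometric_path_set e) P & #|P| = ipp e.
Proof.
rewrite /ipp; case: arg_minnP => [|Q pQ _]; last by exists Q.
exact: isometric_partition1.
Qed.

Lemma indpp_le P : path_partition (induced_path_set e) P -> indpp e <= #|P|.
Proof.
rewrite /indpp; case: arg_minnP => [|Q _ minQ /minQ //].
exact: induced_partition1.
Qed.

Lemma indpp_attained :
  exists2 P, path_partition (induced_path_set e) P & #|P| = indpp e.
Proof.
rewrite /indpp; case: arg_minnP => [|Q pQ _]; last by exists Q.
exact: induced_partition1.
Qed.

Lemma isometric_edge x y : e x y -> isometric_path_set e [set x; y].
Proof.
move=> exy; apply/isometric_path_setP; exists x, [:: y]; split.
  apply/isometric_pathP; rewrite /gpath /= exy inE (edge_neq eirr exy); split=> //.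
  by case=> //= _ def_y; rewrite -def_y eirr in exy.
by apply/setP=> z; rewrite !inE.
Qed.

Lemma isometric_set1 x : isometric_path_set e [set x].
Proof.
apply/isometric_path_setP; exists x, [::].
by split; [apply/isometric_pathP | rewrite set_seq1].
Qed.

(** A chord between two nonconsecutive vertices would shorten the path. *)
Lemma isometric_induced x p : isometric_path e x p -> induced_path e (x :: p).
Proof.
case/isometric_pathP=> /andP[ep up] min_p; apply/and3P; split=> //.
have aux u v : u \in x :: p -> v \in x :: p -> index u (x :: p) < index v (x :: p) ->
    e u v = ((index u (x :: p)).+1 == index v (x :: p)).
  move=> us vs; set i := index u _; set j := index v _ => ij.
  have [iu jv] : nth x (x :: p) i = u /\ nth x (x :: p) j = v by rewrite !nth_index.
  have jp : j <= size p by rewrite -ltnS -[(size p).+1]/(size (x :: p)) index_mem.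
  apply/idP/eqP=> [euv | ij1]; last first.
    by rewrite -iu -jv -ij1; apply: (pathP x ep); rewrite ij1.
  (* The path shortened by the edge u v; the positions i and j refer to x :: p,
  hence the predecessor in drop. *)
  pose q := take i p ++ drop j.-1 p.
  have last_i : last x (take i p) = u.
    rewrite (last_nth x) size_takel; last lia.
    by rewrite -[x :: take i p]/(take i.+1 (x :: p)) nth_take.
  have drop_j : drop j.-1 p = v :: drop j p.
    rewrite -[v]jv; case: (j) ij jp => // k _ kp; by rewrite (drop_nth x).
  have gq : gpath e x q.
    rewrite /gpath /q cat_path last_i drop_j [path e u _]/= euv; apply/andP; split.
      have /andP[-> _] : path e x (take i p) && path e (last x (take i p)) (drop i p).
        by rewrite -cat_path cat_take_drop.
      rewrite /=.
      by move: ep; rewrite -{1}(cat_take_drop j.-1 p) cat_path drop_j /= => /and3P[].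
    apply: subseq_uniq up; rewrite -cat_cons -drop_j.
    have -> : drop j.-1 p = drop (j.-1 - i) (drop i p).
      by rewrite drop_drop; congr drop; lia.
    rewrite -[in X in subseq _ X](cat_take_drop i p) -cat_cons.
    by apply: cat_subseq => //; apply: drop_subseq.
  have := min_p q gq.
  rewrite /q last_cat drop_j /= size_cat /= size_drop size_takel; last lia.
  have -> : last v (drop j p) = last x p.
    by rewrite -{2}(cat_take_drop j.-1 p) last_cat drop_j.
  by move=> /(_ erefl); lia.
apply/forall_inP=> u us; apply/forall_inP=> v vs; apply/eqP.
have [lt | gt | eq] := ltngtP (index u (x :: p)) (index v (x :: p)).
- by rewrite aux // [X in _ || X]gtn_eqF ?orbF // ltnS ltnW.
- by rewrite esym aux // [X in X || _]gtn_eqF // ltnS ltnW.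
have -> : u = v by rewrite -(nth_index x us) eq nth_index.
by rewrite eirr; lia.
Qed.

Lemma isometric_induced_set S : isometric_path_set e S -> induced_path_set e S.
Proof.
case/isometric_path_setP=> x [p [/isometric_induced ip ->]].
by apply/induced_path_setP; exists (x :: p).
Qed.

Lemma indpp_le_ipp : indpp e <= ipp e.
Proof.
have [P /andP[pP /forall_inP iP] <-] := ipp_attained; apply: indpp_le.
by rewrite /path_partition pP; apply/forall_inP=> S /iP/isometric_induced_set.
Qed.

Lemma matching_completion_isometric M : matching e M ->
  path_partition (isometric_path_set e) (singleton_completion M).
Proof.
move=> mM; have [pP _] := partition_matching eirr mM.
rewrite /path_partition pP; apply/forall_inP=> A AP.
have /set0Pn[x xA] : A != set0 by apply: contraTneq AP => ->; case/and3P: pP.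
have [-> | [_ [y eyx ->]]] := matching_completion_mem mM esym AP xA.
  exact: isometric_set1.
exact: isometric_edge.
Qed.

Lemma ipp_le_matching : ipp e <= #|T| - nu e.
Proof.
have [M mM <-] := nu_attained e; have [_ <-] := partition_matching eirr mM.
by apply/ipp_le/matching_completion_isometric.
Qed.
End Paths.

(** * Counting over the blocks *)

Section Extremal.
Variables (T : finType) (e : rel T).
Hypotheses (esym : symmetric e) (eirr : irreflexive e).
Hypothesis (eblock : block_graph e).
Implicit Types (x y z u v w r : T) (S A B E : {set T}) (M P : {set {set T}}).

Lemma block_gt0 B : block e B -> 0 < #|B|.
Proof. by rewrite card_gt0; apply: block_neq0. Qed.

Lemma sum_setI_partition P B : partition P [set: T] -> \sum_(S in P) #|S :&: B| = #|B|.
Proof.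
move=> pP; have tP : trivIset P by case/and3P: pP.
transitivity (\sum_(x in cover P) (x \in B)).
  rewrite (big_trivIset _ tP) /=; apply: eq_bigr => S _.
  rewrite -sum1_card big_mkcond [RHS]big_mkcond; apply: eq_bigr => x _.
  by rewrite inE; do 2!case: (_ \in _).
rewrite (cover_partition pP) -sum1_card [RHS]big_mkcond.
by apply: eq_big => x; rewrite ?inE //; case: (_ \in _).
Qed.

(** Distinct edges of an induced path lie in distinct blocks, since blocks are
    complete and an induced path has no triangle; the sum counts the blocks
    that contain at least two vertices of S. *)
Lemma induced_path_blocks S : induced_path_set e S ->
  #|S| <= \sum_(B | block e B) (1 < #|S :&: B|) + 1.
Proof.
case/induced_path_setP=> -[|x0 p] /and3P[] // _ us ind ->; set s := x0 :: p in us ind *.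
have adj i j : i < size s -> j < size s ->
    e (nth x0 s i) (nth x0 s j) = (i.+1 == j) || (j.+1 == i).
  move=> ilt jlt; have /forall_inP indi := forall_inP ind _ (mem_nth x0 ilt).
  have /eqP := indi _ (mem_nth x0 jlt).
  by rewrite !index_uniq.
have /fin_all_exists[f fP] (i : 'I_(size p)) :
    exists B, [/\ block e B, nth x0 s i \in B & nth x0 s i.+1 \in B].
  have [|B bB [iB i1B]] := @edge_block _ e esym (nth x0 s i) (nth x0 s i.+1).
    by have sz : i.+1 < size s := ltn_ord i; rewrite adj ?eqxx // ltnW.
  by exists B.
have lt_f (i j : 'I_(size p)) : f i = f j -> j <= i.
  move=> fij; rewrite leqNgt; apply/negP=> ij.
  have [[bB iB _] [_ _ jB]] := (fP i, fP j); rewrite -fij in jB.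
  have [isz jsz] : i < size s /\ j.+1 < size s := conj (ltnW (ltn_ord i)) (ltn_ord j).
  have neq : nth x0 s i != nth x0 s j.+1 by rewrite nth_uniq // neq_ltn ltnW.
  by have := block_adj eblock bB iB jB neq; rewrite adj //; lia.
have inj_f : injective f.
  by move=> i j fij; apply/val_inj/eqP; rewrite eqn_leq /= !lt_f.
rewrite cardsE (card_uniqP us) /= addn1 ltnS -big_mkcondr sum1dep_card.
rewrite -[X in X <= _]card_ord -(card_imset _ inj_f) subset_leq_card //.
apply/subsetP=> _ /imsetP[i _ ->]; have [bB iB i1B] := fP i; rewrite inE bB /=.
have neq : nth x0 s i != nth x0 s i.+1.
  by rewrite nth_uniq //= ?ltnS ?(ltnW (ltn_ord i)) // neq_ltn ltnSn.
have sz : i.+1 < size s by rewrite ltnS.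
have <- : #|[set nth x0 s i; nth x0 s i.+1]| = 2 by rewrite cards2 neq.
apply/subset_leq_card/subsetP=> z /set2P[]->; rewrite !in_setI in_set mem_nth //.
exact: ltnW.
Qed.

(** Add up induced_path_blocks over P and exchange the sums: the parts having
    two vertices in B are disjoint, so there are at most #|B|./2 of them. *)
Lemma induced_partition_bound P :
    path_partition (induced_path_set e) P ->
  #|T| <= \sum_(B | block e B) #|B|./2 + #|P|.
Proof.
case/andP=> pP /forall_inP iP.
rewrite -cardsT (card_partition pP).
apply: leq_trans (leq_sum _ (fun S SP => induced_path_blocks (iP S SP))) _.
rewrite big_split /= sum1_card leq_add2r exchange_big; apply: leq_sum => B _.
rewrite geq_half_double -mul2n -(sum_setI_partition B pP) big_distrr.
apply: leq_sum => S _.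
by case: ltnP.
Qed.

Lemma isometric_path3 x y z :
  e x y -> e y z -> x != z -> ~~ e x z -> isometric_path_set e [set x; y; z].
Proof.
move=> exy eyz xz nexz; apply/isometric_path_setP; exists x, [:: y; z]; split.
  apply/isometric_pathP; split.
    by rewrite /gpath /= exy eyz !inE negb_or xz !(edge_neq eirr).
  case=> [|a [|b q]] //= gq def_z; first by rewrite def_z eqxx in xz.
  by case/andP: gq; rewrite /= def_z (negPf nexz).
by apply/setP=> t; rewrite !inE orbA.
Qed.

(** A shorter path from x' to y' either passes through x, so that y' is
    adjacent to both x and y, or extends by y to a path from x' to y in the
    graph minus x; both put one of x', y' into B. *)
Lemma isometric_path4 B x y x' y' :
    block e B -> x \in B -> y \in B -> x != y -> x' \notin B -> y' \notin B ->
    e x' x -> e y y' -> x' != y' ->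
  isometric_path_set e [set x'; x; y; y'].
Proof.
move=> bB xB yB xy x'B y'B ex eyy' x'y'; have exy := block_adj eblock bB xB yB xy.
have [ex' y'x] : e x x' /\ y' != x by rewrite esym; split=> //; apply: contraNneq y'B => ->.
have x'y : x' != y by apply: contraNneq x'B => ->.
have y'x' a : a != x -> e y' a -> connect (induced_rel e [set~ x]) a x' -> False.
  move=> ax ey'a cax'; case/negP: x'B.
  apply: (block_absorb esym eirr eblock bB xB yB xy ex').
  apply: (@connect_trans _ _ y'); first by apply: edge_connect; rewrite ?inE // eq_sym.
  by apply: connect_trans cax'; apply: edge_connect; rewrite ?inE.
apply/isometric_path_setP; exists x', [:: x; y; y']; split.
  apply/isometric_pathP; split.
    rewrite /gpath /= ex exy eyy' !inE !negb_or x'y x'y' xy (eq_sym x) y'x.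
    by rewrite !(edge_neq eirr).
  case=> [|a [|b [|c q]]] //= gq; first by move=> def_y'; rewrite def_y' eqxx in x'y'.
    move=> def_y'; rewrite def_y' in gq; case/andP: gq => /andP[ex'y' _] _.
    (* With an edge from x' to y', the path x', y', y avoids x. *)
    by case: (y'x' x'); rewrite 1?(edge_neq eirr) // esym.
  (* Likewise x', a, y', y avoids x, unless a is x. *)
  move=> def_y'; rewrite def_y' in gq; case/andP: gq => /and3P[ex'a eay' _] _.
  have [def_a | ax] := eqVneq a x; last first.
    case: (y'x' a); rewrite 1?esym //.
    by apply: edge_connect; rewrite ?inE 1?esym // (edge_neq eirr).
  case/negP: y'B; apply: (block_triangle esym eirr eblock bB xB yB xy) => //.
  by rewrite -def_a.
by apply/setP=> t; rewrite !inE !orbA.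
Qed.

(** Complete M by singletons to a partition and merge the parts of x and y
    along the edge xy. The partners of x and y, if any, are outside B, which
    makes the merged path isometric. *)
Lemma ipp_lt_matching M B x y :
    matching e M -> block e B -> x \in B -> y \in B -> x != y ->
    {in M, forall E, E \subset B -> (x \notin E) && (y \notin E)} ->
  ipp e < #|T| - #|M|.
Proof.
move=> mM bB xB yB xy xyM; have [pP <-] := partition_matching eirr mM.
have /andP[_ /forall_inP isoP] := matching_completion_isometric esym eirr mM.
set P := singleton_completion M in pP isoP *.
have ex_part z : exists2 A, A \in P & z \in A.
  by apply/bigcupP; rewrite -/(cover P) (cover_partition pP) inE.
have part_mem z A : z \in B -> A \in P -> z \in A ->
    {in M, forall E, E \subset B -> z \notin E} ->
    A = [set z] \/ exists z', [/\ e z' z, z' \notin B & A = [set z'; z]].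
  move=> zB AP zA zM; have [-> | [AM [z' ez'z def_A]]] :=
    matching_completion_mem mM esym AP zA.
    by left.
  right; exists z'; split=> //; apply/negP=> z'B.
  have AB : A \subset B by rewrite def_A; apply/subsetP=> t /set2P[]->.
  by have := zM A AM AB; rewrite zA.
have xM : {in M, forall E, E \subset B -> x \notin E} by move=> E EM /(xyM E EM)/andP[].
have yM : {in M, forall E, E \subset B -> y \notin E} by move=> E EM /(xyM E EM)/andP[].
have [[A AP xA] [C CP yC]] := (ex_part x, ex_part y).
have shapeA := part_mem x A xB AP xA xM; have shapeC := part_mem y C yB CP yC yM.
have AC : A != C.
  apply/eqP=> def_C; rewrite -def_C in yC.
  case: shapeA => [def_A | [x' [_ x'B def_A]]]; move: yC; rewrite def_A !inE.
    by rewrite eq_sym (negPf xy).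
  by rewrite orbC eq_sym (negPf xy) => /eqP def_y; rewrite -def_y yB in x'B.
have dAC : [disjoint A & C] by case/and3P: pP => _ /trivIsetP tP _; apply: tP.
have [pP' card_P'] := partition_merge pP AP CP AC.
rewrite -card_P' ltnS; apply: ipp_le; rewrite /path_partition pP'.
apply/forall_inP=> S; rewrite in_setU1 => /predU1P[-> | ]; last first.
  by rewrite !in_setD1 => /and3P[_ _ /isoP].
have exy := block_adj eblock bB xB yB xy.
have nonadj z z' w : z \in B -> w \in B -> z != w -> e z' z -> z' \notin B ->
    (z' != w) && ~~ e z' w.
  move=> zB wB zw ez z'B; apply/andP; split; first by apply: contraNneq z'B => ->.
  apply: contra z'B => ew.
  by apply: (block_triangle esym eirr eblock bB zB wB zw); rewrite esym.
case: shapeA shapeC => [-> | [x' [ex x'B def_A]]] [-> | [y' [ey y'B def_C]]].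
- exact: isometric_edge.
- have yx : y != x by rewrite eq_sym.
  have /andP[y'x ney'x] := nonadj y y' x yB xB yx ey y'B.
  have -> : [set x] :|: C = [set y'; y; x] by rewrite def_C setUC.
  by apply: isometric_path3; rewrite // esym.
- have /andP[x'y nex'y] := nonadj x x' y xB yB xy ex x'B.
  by rewrite def_A; apply: isometric_path3.
have -> : A :|: C = [set x'; x; y; y'].
  by rewrite def_A def_C -[in RHS]setUA (setUC [set y]).
apply: (isometric_path4 bB) => //; first by rewrite esym.
apply/eqP=> def_x'; have /pred0P/(_ x') := dAC.
by rewrite /= def_A def_C def_x' !inE eqxx.
Qed.

Lemma sum_half_block_le_nu : ipp e = #|T| - nu e ->
  \sum_(B | block e B) #|B|./2 <= nu e.
Proof.
move=> ext; have [M mM card_M] := nu_attained e; rewrite -card_M.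
apply: (sum_half_le_matching eirr mM (F := id)) =>
  [E A B EM bA bB sEA sEB | B x y bB xB yB xyM].
  case/andP: mM => /subsetP/(_ E EM)/edgesP[x [y [exy def_E]]] _.
  by apply: (block_eq esym eirr eblock bA bB (x := x) (y := y)); rewrite ?(edge_neq eirr) //;
    apply: (subsetP sEA) || apply: (subsetP sEB); rewrite def_E !inE eqxx ?orbT.
apply/eqP/negPn/negP=> xy; have := ipp_lt_matching mM bB xB yB xy xyM.
by rewrite ext card_M ltnn.
Qed.

Hypothesis econn : connected_graph e.

(** Map each vertex other than a root r to its parent block; at least one
    vertex of a block is not counted there. *)
Lemma card_le_blocks : #|T| <= \sum_(B | block e B) #|B|.-1 + 1.
Proof.
have /set0Pn[r _] := (andP econn).1.
rewrite -cardsT (cardsD1 r) inE addnC leq_add2r.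
rewrite -sum1_card (partition_big (parent_block e r) (block e)) /=; last first.
  by move=> v; rewrite !inE andbT => /(block_parent esym eirr eblock econn)[].
apply: leq_sum => B bB; have [b bB' root_b] := block_root esym r econn bB.
rewrite sum1dep_card (cardsD1 b B) bB' /= subset_leq_card //.
apply/subsetP=> v; rewrite !inE andbT => /andP[vr /eqP def_B]; apply/andP; split.
  apply/eqP=> def_v; rewrite -def_v in root_b.
  by case: root_b => [def_r | /eqP //]; rewrite def_r eqxx in vr.
by rewrite -def_B; case: (block_parent esym eirr eblock econn vr).
Qed.

(** For any B, 2 * #|B|./2 is #|B|.-1, plus one if #|B| is even. Summing over
    the blocks bounds n - 1 plus the number of even blocks by 2 * nu <= n. *)
Lemma even_blocks_le1 : ipp e = #|T| - nu e ->
  #|[set B : {set T} | block e B & ~~ odd #|B| ]| <= 1.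
Proof.
move=> /sum_half_block_le_nu le_nu; have := nu_half eirr; have := card_le_blocks.
suff : \sum_(B | block e B) #|B|.-1 + #|[set B : {set T} | block e B & ~~ odd #|B| ]|
   = 2 * \sum_(B | block e B) #|B|./2 by lia.
rewrite -sum1dep_card big_mkcondr -big_split big_distrr; apply: eq_bigr => B bB /=.
by have := block_gt0 bB; case: ifP; lia.
Qed.

(** Rooting at a vertex r of B0 turns B0, together with the sets of non-root
    vertices of the other blocks, into disjoint cliques. The latter sets have
    even size, so a matching that is maximal inside these cliques is large
    enough. *)
Lemma nu_ge_half_blocks r B0 :
    block e B0 -> r \in B0 ->
    (forall B, block e B -> B != B0 -> odd #|B|) ->
  \sum_(B | block e B) #|B|./2 <= nu e.
Proof.
move=> bB0 rB0 oddB; pose home v := if v == r then B0 else parent_block e r v.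
pose F B := [set v | home v == B].
have homeP v : block e (home v) /\ v \in home v.
  rewrite /home; case: eqVneq => [-> | vr]; first by split.
  exact: (block_parent esym eirr eblock econn vr).
have sFB B : F B \subset B by apply/subsetP=> v; rewrite inE => /eqP<-; case: (homeP v).
have half_le B : block e B -> #|B|./2 <= #|F B|./2.
  move=> bB; have home_eq u v :
      u \in B -> v \in B -> u != v -> (u \in F B) || (v \in F B).
    move=> uB vB uv; rewrite !inE /home.
    have := block_parent_or esym eirr eblock econn r bB uB vB uv.
    by case=> -[/negPf-> ->]; rewrite eqxx ?orbT.
  (* The root r counts as a vertex whose parent block is B0, so no vertex of B0
  is lost, whereas any other block may lose one. *)
  have [def_B | BB0] := eqVneq B B0.
    suff : #|B| <= #|F B| by lia.
    apply/subset_leq_card/subsetP=> v vB.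
    have rF : r \in F B by rewrite inE /home eqxx def_B.
    have [-> // | vr] := eqVneq v r.
    have rB : r \in B by rewrite def_B.
    have := block_parent_or esym eirr eblock econn r bB vB rB vr.
    by case=> -[/negPf nr def_v]; [rewrite inE /home nr def_v | rewrite eqxx in nr].
  have := oddB B bB BB0.
  suff : #|B| <= #|F B| + 1 by lia.
  rewrite -(cardsID (F B) B) leq_add ?subset_leq_card ?subsetIr //.
  apply/card_le1_eqP=> u v /setDP[uB uF] /setDP[vB vF]; apply/eqP/negPn/negP=> vu.
  by have := home_eq v u vB uB vu; rewrite (negPf uF) (negPf vF).
apply: leq_trans (leq_sum _ half_le) _.
pose good M := matching e M && [forall E in M, [exists B, E \subset F B]].
have good0 : good set0.
  rewrite /good /matching sub0set /=; apply/andP; split.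
    by apply/trivIsetP=> A B; rewrite inE.
  by apply/forall_inP=> E; rewrite inE.
have [M /maxsetP[/andP[mM /forall_inP FM] maxM] _] := maxset_exists good0.
apply: leq_trans (nu_max mM).
have sM : {in M, forall E, exists x y, e x y /\ E = [set x; y]}.
  by move=> E EM; apply/edgesP; apply: (subsetP (andP mM).1).
apply: (sum_half_le_matching eirr mM) => [E A B EM _ _ | B x y bB xF yF xyM].
  have [x [y [_ ->]]] := sM E EM; rewrite !subUset !sub1set !inE.
  by case/andP=> /eqP<- _ /andP[/eqP].
apply/eqP/negPn/negP=> xy.
have exy : e x y by apply: (block_adj eblock bB _ _ xy); apply: (subsetP (sFB B)).
have disE : {in M, forall E, [disjoint [set x; y] & E]}.
  move=> E EM; have [C sEC] := existsP (FM E EM).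
  rewrite -setI_eq0; apply/eqP/setP=> z; rewrite !inE; apply/negP=> /andP[zxy zE].
  have zB : z \in F B by case/orP: zxy => /eqP->.
  have zC := subsetP sEC z zE; rewrite !inE in zB zC.
  rewrite -(eqP zC) (eqP zB) in sEC.
  have /andP[xE yE] := xyM E EM sEC.
  by case/orP: zxy => /eqP def_z; rewrite -def_z zE in xE yE.
have M0 : set0 \notin M.
  by apply/negP=> /sM[a [b [_ /setP/(_ a)]]]; rewrite !inE eqxx.
have [tM' xyNM] := trivIsetU1 disE (andP mM).2 M0.
case/negP: xyNM; rewrite -(maxM ([set x; y] |: M)) ?subsetU1 ?setU11 //.
apply/andP; split; last first.
  apply/forall_inP=> E /setU1P[-> | /FM //].
  by apply/existsP; exists B; apply/subsetP=> z /set2P[]->.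
apply/andP; split=> //; apply/subsetP=> E /setU1P[-> | /sM ?]; apply/edgesP => //.
by exists x, y.
Qed.

Lemma indpp_ge : #|[set B : {set T} | block e B & ~~ odd #|B| ]| <= 1 ->
  #|T| - nu e <= indpp e.
Proof.
move=> even1; have [P pP <-] := indpp_attained eirr.
have := induced_partition_bound pP.
suff : \sum_(B | block e B) #|B|./2 <= nu e by lia.
have even_eq A B : block e A -> block e B -> ~~ odd #|A| -> ~~ odd #|B| -> A = B.
  by move=> bA bB eA eB; apply: (card_le1_eqP even1); rewrite inE ?bA ?bB.
have [B0 /andP[bB0 eB0] | no] := pickP [pred B | block e B && ~~ odd #|B|].
  have /set0Pn[r rB0] := block_neq0 bB0; apply: (nu_ge_half_blocks bB0 rB0) => B bB.
  by apply: contraR => eB; apply/eqP; apply: even_eq.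
have /set0Pn[r _] := (andP econn).1.
have [|B0 bB0 sB0] := @biconnected_block _ e [set r].
  apply: (complete_biconnected esym); first by apply/set0Pn; exists r; rewrite set11.
  by apply/forall_inP=> a /set1P->; apply/forall_inP=> b /set1P->; rewrite eqxx.
apply: (nu_ge_half_blocks bB0 (r := r)) => [|B bB _]; first by rewrite -sub1set.
by have := no B; rewrite /= bB => /negbFE.
Qed.
End Extremal.

Theorem corollary3p5 (T : finType) (e : rel T)
    (esym : symmetric e) (eirr : irreflexive e) (Tgt0 : 0 < #|T|)
    (econn : connected_graph e) (eblock : block_graph e) :
  [<-> IPP_extremal e;
       IndPP_extremal e;
       #|[set B : {set T} | block e B & ~~ odd #|B| ]| <= 1].
Proof.
have ind_ipp := indpp_le_ipp esym eirr; have ipp_up := ipp_le_matching esym eirr.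
have ext_even := even_blocks_le1 esym eirr eblock econn.
have even_ext := indpp_ge esym eirr eblock econn.
rewrite /IPP_extremal /IndPP_extremal; tfae.
- move=> /ext_even/even_ext ind_ge; apply/eqP.
  by rewrite eqn_leq ind_ge (leq_trans ind_ipp).
- by move=> ind_ext; apply/ext_even/eqP; rewrite eqn_leq ipp_up -ind_ext.
move=> /even_ext ind_ge; apply/eqP.
by rewrite eqn_leq ipp_up (leq_trans ind_ge).
Qed.
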